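(* Let $F:\mathcal{A}\to \mathcal{B}$ be a fully faithful covariant functor between abelian categories. Let $M$ and $N$ be objects of $\mathcal{A}$. (i) Assume that $\mathrm{Im}(F)$ is closed under kernels or cokernels. (1) If $F$ is left exact and $N$ is $M$-CS-Rickart, then $F(N)$ is $F(M)$-CS-Rickart. (2) If $F$ is right exact and $N$ is dual $M$-CS-Rickart, then $F(N)$ is dual $F(M)$-CS-Rickart. (ii) Assume that $\mathrm{Im}(F)$ is closed under direct summands. (1) If $F$ is left exact and $F(N)$ is $F(M)$-CS-Rickart, then $N$ is $M$-CS-Rickart. (2) If $F$ is right exact and $F(N)$ is dual $F(M)$-CS-Rickart, then $N$ is dual $M$-CS-Rickart.
   Context: For a covariant functor $F:\mathcal{A}\to\mathcal{B}$, $\mathrm{Im}(F)$ denotes the essential image of $F$, which consists of all objects $B$ of $\mathcal{B}$ such that $B\cong F(A)$ for some object $A$ of $\mathcal{A}$. In an abelian category, a morphism $f:A\to B$ is a section (respectively, a retraction) if there is a morphism $f':B\to A$ such that $f'f=1_A$ (respectively, $ff'=1_B$). A monomorphism $f:X\to Y$ is essential if for every morphism $h:Y\to P$ such that $hf$ is a monomorphism, $h$ is a monomorphism. An epimorphism $f:X\to Y$ is superfluous if for every morphism $h:P\to X$ such that $fh$ is an epimorphism, $h$ is an epimorphism. For objects $M$ and $N$ of an abelian category, $N$ is $M$-CS-Rickart if for every morphism $f:M\to N$ there are an essential monomorphism $e:\mathrm{Ker}(f)\to L$ and a section $s:L\to M$ such that $\ker(f)=se$, where $\ker(f):\mathrm{Ker}(f)\to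 M$ is the kernel of $f$. The object $N$ is dual $M$-CS-Rickart if for every morphism $f:M\to N$ there are a retraction $r:N\to P$ and a superfluous epimorphism $t:P\to \mathrm{Coker}(f)$ such that $\mathrm{coker}(f)=tr$, where $\mathrm{coker}(f):N\to\mathrm{Coker}(f)$ is the cokernel of $f$. *)

(* Defs.v *)
From mathcomp Require Import all_boot all_algebra.

Set Implicit Arguments.
Unset Strict Implicit.
Unset Printing Implicit Defensive.

Import GRing.Theory.
Local Open Scope ring_scope.

Record preadditive_category := PreadditiveCategory {
  obj :> Type;
  hom : obj -> obj -> zmodType;
  idm : forall X, hom X X;
  comp : forall X Y Z, hom Y Z -> hom X Y -> hom X Z;
  comp_idl : forall X Y (f : hom X Y), comp (idm Y) f = f;
  comp_idr : forall X Y (f : hom X Y), comp f (idm X) = f;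
  compA : forall W X Y Z (h : hom Y Z) (g : hom X Y) (f : hom W X),
    comp h (comp g f) = comp (comp h g) f;
  compDl : forall X Y Z (g g' : hom Y Z) (f : hom X Y),
    comp (g + g') f = comp g f + comp g' f;
  compDr : forall X Y Z (g : hom Y Z) (f f' : hom X Y),
    comp g (f + f') = comp g f + comp g f'
}.

Arguments hom {p} X Y.
Arguments idm {p} X.
Arguments comp {p X Y Z} g f.

Notation "g \oc f" := (comp g f) (at level 40, left associativity).

Section CategoricalNotions.

Context {C : preadditive_category}.

Definition mono (X Y : C) (f : hom X Y) : Prop :=
  forall (W : C) (g h : hom W X), f \oc g = f \oc h -> g = h.

Definition epi (X Y : C) (f : hom X Y) : Prop :=
  forall (Z : C) (g h : hom Y Z), g \oc f = h \oc f -> g = h.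

Definition isomorphic (X Y : C) : Prop :=
  exists (f : hom X Y) (g : hom Y X), g \oc f = idm X /\ f \oc g = idm Y.

Definition is_section (X Y : C) (f : hom X Y) : Prop :=
  exists f' : hom Y X, f' \oc f = idm X.

Definition is_retraction (X Y : C) (f : hom X Y) : Prop :=
  exists f' : hom Y X, f \oc f' = idm Y.

Definition is_kernel (X Y K : C) (f : hom X Y) (k : hom K X) : Prop :=
  f \oc k = 0 /\
  forall (W : C) (g : hom W X), f \oc g = 0 -> exists! u : hom W K, k \oc u = g.

Definition is_cokernel (X Y Q : C) (f : hom X Y) (c : hom Y Q) : Prop :=
  c \oc f = 0 /\
  forall (Z : C) (g : hom Y Z), g \oc f = 0 -> exists! u : hom Q Z, u \oc c = g.

Definition is_zero_object (Z : C) : Prop :=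
  forall X : C, (forall f : hom X Z, f = 0) /\ (forall f : hom Z X, f = 0).

Definition is_biproduct (X Y S : C)
    (i : hom X S) (j : hom Y S) (p : hom S X) (q : hom S Y) : Prop :=
  [/\ p \oc i = idm X, q \oc j = idm Y, q \oc i = 0, p \oc j = 0
    & i \oc p + j \oc q = idm S].

Definition is_direct_summand (X S : C) : Prop :=
  exists (Y : C) (i : hom X S) (j : hom Y S) (p : hom S X) (q : hom S Y),
    is_biproduct i j p q.

Definition essential_mono (X Y : C) (f : hom X Y) : Prop :=
  mono f /\ forall (P : C) (h : hom Y P), mono (h \oc f) -> mono h.

Definition superfluous_epi (X Y : C) (f : hom X Y) : Prop :=
  epi f /\ forall (P : C) (h : hom P X), epi (f \oc h) -> epi h.

(* Kernels and cokernels are determined only up to isomorphism, so the next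
   two conditions are imposed for every choice of ker f, resp. coker f. *)

(* CS_Rickart M N reads: N is M-CS-Rickart. *)
Definition CS_Rickart (M N : C) : Prop :=
  forall (f : hom M N) (K : C) (k : hom K M), is_kernel f k ->
  exists (L : C) (e : hom K L) (s : hom L M),
    [/\ essential_mono e, is_section s & k = s \oc e].

(* dual_CS_Rickart M N reads: N is dual M-CS-Rickart. *)
Definition dual_CS_Rickart (M N : C) : Prop :=
  forall (f : hom M N) (Q : C) (c : hom N Q), is_cokernel f c ->
  exists (P : C) (r : hom N P) (t : hom P Q),
    [/\ is_retraction r, superfluous_epi t & c = t \oc r].

(* The kernel of a morphism f : X -> Y is required to lie in S as soon as its
   domain X does, and dually for cokernels: the other end of f is an arbitrary
   object of C.  Restricting to morphisms with both ends in S would give a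
   strictly weaker condition: it holds for the image of every fully faithful
   exact functor. *)
Definition closed_under_kernels (S : C -> Prop) : Prop :=
  forall (X Y K : C) (f : hom X Y) (k : hom K X), is_kernel f k -> S X -> S K.

Definition closed_under_cokernels (S : C -> Prop) : Prop :=
  forall (X Y Q : C) (f : hom X Y) (c : hom Y Q), is_cokernel f c -> S Y -> S Q.

Definition closed_under_direct_summands (S : C -> Prop) : Prop :=
  forall X Y : C, is_direct_summand X Y -> S Y -> S X.

End CategoricalNotions.

Record abelian_category := AbelianCategory {
  abelian_base :> preadditive_category;
  has_zero_object : exists Z : abelian_base, is_zero_object Z;
  has_biproducts : forall X Y : abelian_base,
    exists (S : abelian_base)
      (i : hom X S) (j : hom Y S) (p : hom S X) (q : hom S Y),
      is_biproduct i j p q;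
  has_kernels : forall (X Y : abelian_base) (f : hom X Y),
    exists (K : abelian_base) (k : hom K X), is_kernel f k;
  has_cokernels : forall (X Y : abelian_base) (f : hom X Y),
    exists (Q : abelian_base) (c : hom Y Q), is_cokernel f c;
  mono_normal : forall (X Y : abelian_base) (f : hom X Y), mono f ->
    exists (Z : abelian_base) (g : hom Y Z), is_kernel g f;
  epi_conormal : forall (X Y : abelian_base) (f : hom X Y), epi f ->
    exists (W : abelian_base) (g : hom W X), is_cokernel g f
}.

(* Functors are not required to be additive. *)
Record functor (A B : preadditive_category) := Functor {
  fobj :> A -> B;
  fmap : forall X Y : A, hom X Y -> hom (fobj X) (fobj Y);
  fmap_id : forall X : A, fmap (idm X) = idm (fobj X);
  fmap_comp : forall (X Y Z : A) (g : hom Y Z) (f : hom X Y),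
    fmap (g \oc f) = fmap g \oc fmap f
}.

Arguments fmap {A B} F {X Y} f : rename.

Section FunctorNotions.

Context {A B : preadditive_category} (F : functor A B).

Definition faithful : Prop :=
  forall (X Y : A) (f g : hom X Y), fmap F f = fmap F g -> f = g.

Definition full : Prop :=
  forall (X Y : A) (g : hom (F X) (F Y)), exists f : hom X Y, fmap F f = g.

Definition fully_faithful : Prop := full /\ faithful.

(* Between abelian categories, 0 -> K -> X -> Y is exact iff K -> X is a kernel
   of X -> Y.  A functor preserving such sequences is automatically additive and
   preserves all finite limits; dually for right exactness. *)
Definition left_exact : Prop :=
  forall (X Y K : A) (f : hom X Y) (k : hom K X),
    is_kernel f k -> is_kernel (fmap F f) (fmap F k).

Definition right_exact : Prop :=
  forall (X Y Q : A) (f : hom X Y) (c : hom Y Q),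
    is_cokernel f c -> is_cokernel (fmap F f) (fmap F c).

Definition essential_image (Y : B) : Prop :=
  exists X : A, isomorphic Y (F X).

End FunctorNotions.

(* Main.v *)
(** The two dual assertions are obtained by applying the others to the functor
    that [F] induces between the opposite categories.

    For (i)(1), a kernel [k = s e] of [f : M -> N] is sent by [F] to a kernel of
    [F f], and only the essentiality of [F e : F K -> F L] is at stake.  Let
    [h] be such that [h (F e)] is a monomorphism, and let [x] be a kernel of [h].
    If [x] comes from [A], its cokernel [c] in [A] satisfies: [c e] is a
    monomorphism, because [Im x] meets [Im e] trivially; hence [c] is a
    monomorphism and [x = 0].  If instead [coker x] is, up to isomorphism, some [F y],
    then [y e] is a monomorphism since [h] factors through [F y]; hence so
    are [y], [F y], and again [x = 0].

    For (ii)(1), the middle term of a factorization of [F k] is a direct summand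
    of [F M], hence it comes from [A], and essentiality descends along [F]. *)
From mathcomp Require Import all_boot all_algebra.
Require Import Defs.

Set Implicit Arguments.
Unset Strict Implicit.
Unset Printing Implicit Defensive.

Import GRing.Theory.
Local Open Scope ring_scope.

(** * Monomorphisms and kernels in preadditive categories *)

Section Preadditive.
Context {C : preadditive_category}.

Lemma comp0l (X Y Z : C) (f : hom X Y) : (0 : hom Y Z) \oc f = 0.
Proof. by apply: (addrI (0 \oc f)); rewrite -compDl !addr0. Qed.

Lemma comp0r (X Y Z : C) (g : hom Y Z) : g \oc (0 : hom X Y) = 0.
Proof. by apply: (addrI (g \oc 0)); rewrite -compDr !addr0. Qed.

Lemma compNl (X Y Z : C) (g : hom Y Z) (f : hom X Y) : (- g) \oc f = - (g \oc f).
Proof. by apply/eqP; rewrite -addr_eq0 -compDl addNr comp0l. Qed.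

Lemma compNr (X Y Z : C) (g : hom Y Z) (f : hom X Y) : g \oc (- f) = - (g \oc f).
Proof. by apply/eqP; rewrite -addr_eq0 -compDr addNr comp0r. Qed.

Lemma monoP (X Y : C) (f : hom X Y) :
  (forall (W : C) (g : hom W X), f \oc g = 0 -> g = 0) -> mono f.
Proof.
move=> f0 W g h fgh; apply/eqP; rewrite -subr_eq0; apply/eqP/f0.
by rewrite compDr compNr fgh subrr.
Qed.

Lemma mono_eq0 (X Y W : C) (f : hom X Y) (g : hom W X) :
  mono f -> f \oc g = 0 -> g = 0.
Proof. by move=> f_mono fg0; apply: f_mono; rewrite comp0r. Qed.

Lemma mono_comp (X Y Z : C) (g : hom Y Z) (f : hom X Y) :
  mono g -> mono f -> mono (g \oc f).
Proof. by move=> g_mono f_mono W u v; rewrite -!compA => /g_mono/f_mono. Qed.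

Lemma mono_compK (X Y Z : C) (g : hom Y Z) (f : hom X Y) :
  mono (g \oc f) -> mono f.
Proof. by move=> gf_mono W u v fuv; apply: gf_mono; rewrite -!compA fuv. Qed.

Lemma section_mono (X Y : C) (f : hom X Y) : is_section f -> mono f.
Proof.
by case=> f' f'f; apply: (@mono_compK _ _ _ f'); rewrite f'f => W u v; rewrite !comp_idl.
Qed.

Lemma essential_mono_isol (X Y Z : C) (u : hom Y Z) (v : hom Z Y) (e : hom X Y) :
  v \oc u = idm Y -> u \oc v = idm Z -> essential_mono e -> essential_mono (u \oc e).
Proof.
move=> vu uv [e_mono e_ess]; split.
  by apply: mono_comp e_mono; apply: section_mono; exists v.
move=> P h; rewrite compA => /e_ess hu_mono.
rewrite -[h]comp_idr -uv compA; apply: mono_comp hu_mono _.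
by apply: section_mono; exists u.
Qed.

Lemma essential_mono_isor (X Y Z : C) (u : hom X Y) (v : hom Y X) (e : hom Y Z) :
  v \oc u = idm X -> u \oc v = idm Y -> essential_mono e -> essential_mono (e \oc u).
Proof.
move=> vu uv [e_mono e_ess]; split.
  by apply: mono_comp e_mono _; apply: section_mono; exists v.
move=> P h heu_mono; apply: e_ess.
rewrite -[h \oc e]comp_idr -uv compA -[_ \oc u]compA.
by apply: mono_comp heu_mono _; apply: section_mono; exists u.
Qed.

Lemma kernel_mono (X Y K : C) (f : hom X Y) (k : hom K X) : is_kernel f k -> mono k.
Proof.
case=> fk0 kU W g h kgh.
have [|u [_ u_uniq]] := kU W (k \oc h); first by rewrite compA fk0 comp0l.
by rewrite -(u_uniq g kgh) -(u_uniq h erefl).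
Qed.

Lemma kernel_lift (X Y K W : C) (f : hom X Y) (k : hom K X) (g : hom W X) :
  is_kernel f k -> f \oc g = 0 -> exists u : hom W K, k \oc u = g.
Proof. by case=> _ kU /kU[u [ku _]]; exists u. Qed.

Lemma kernel_unique (X Y K K' : C) (f : hom X Y) (k : hom K X) (k' : hom K' X) :
  is_kernel f k -> is_kernel f k' ->
  exists (u : hom K' K) (v : hom K K'),
    [/\ v \oc u = idm K', u \oc v = idm K & k' = k \oc u].
Proof.
move=> kP k'P; have [[fk0 _] [fk'0 _]] := (kP, k'P).
have [u ku] := kernel_lift kP fk'0; have [v k'v] := kernel_lift k'P fk0.
exists u, v; split=> //.
  by apply: (kernel_mono k'P); rewrite compA k'v ku comp_idr.
by apply: (kernel_mono kP); rewrite compA ku k'v comp_idr.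
Qed.

Lemma kernel_eq0_mono (X Y K : C) (f : hom X Y) (k : hom K X) :
  is_kernel f k -> k = 0 -> mono f.
Proof.
by move=> kP k0; apply: monoP => W g /(kernel_lift kP)[u <-]; rewrite k0 comp0l.
Qed.

(** Exhibits zero morphisms as kernels, so that left exactness can be applied to them. *)
Lemma id_kernel (X Z : C) (k : hom Z X) : is_zero_object Z -> is_kernel (idm X) k.
Proof.
move=> Z0; rewrite ((Z0 X).2 k); split=> [|W g]; first by rewrite comp0r.
rewrite comp_idl => ->; exists 0; split=> [|u _]; first by rewrite comp0r.
by rewrite ((Z0 W).1 u).
Qed.

End Preadditive.

(** * Normal monomorphisms and direct summands in abelian categories *)

Section Abelian.
Context {C : abelian_category}.

(** By normality [f] is a kernel of some [d]. Since [d f = 0], [d] factors through [c], so whatever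
    [c] kills is killed by [d] and lifts along [f]. *)
Lemma mono_kernel_cokernel (X Y Q : C) (f : hom X Y) (c : hom Y Q) :
  mono f -> is_cokernel f c -> is_kernel c f.
Proof.
move=> f_mono [cf0 cU]; split=> // W g cg0.
have [Z [d fP]] := mono_normal f_mono.
have [t [tc _]] := cU _ _ fP.1.
have [|u fu] := kernel_lift (g := g) fP; first by rewrite -tc -compA cg0 comp0r.
by exists u; split=> // v fv; apply: f_mono; rewrite fu fv.
Qed.

(** The complement is the kernel [j] of a retraction [r] of [s]. The second projection is the lift
    along [j] of the idempotent [1 - s r], which [r] kills. *)
Lemma section_direct_summand (X Y : C) (s : hom X Y) :
  is_section s -> is_direct_summand X Y.
Proof.
case=> r rs; have [K [j jP]] := has_kernels r.
have [|q jq] := kernel_lift (g := idm Y - s \oc r) jP.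
  by rewrite compDr compNr comp_idr compA rs comp_idl subrr.
have j_mono := kernel_mono jP.
exists K, s, j, r, q; split=> //; last by rewrite jq addrC subrK.
- apply: j_mono; rewrite compA jq compDl compNl comp_idl comp_idr -compA.
  by rewrite jP.1 comp0r subr0.
- apply: j_mono; rewrite compA jq compDl compNl comp_idl -compA rs comp_idr.
  by rewrite subrr comp0r.
- exact: jP.1.
Qed.

End Abelian.

(** * Reflection of monomorphisms and sections *)

Lemma faithful_mono_reflect (A B : preadditive_category) (F : functor A B)
    (X Y : A) (f : hom X Y) : faithful F -> mono (fmap F f) -> mono f.
Proof.
move=> F_faithful Ff_mono W u v fuv; apply: F_faithful; apply: Ff_mono.
by rewrite -!fmap_comp fuv.
Qed.

Lemma fully_faithful_section (A B : preadditive_category) (F : functor A B)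
    (X Y : A) (s : hom X Y) :
  fully_faithful F -> is_section (fmap F s) -> is_section s.
Proof.
case=> F_full F_faithful [r0]; have [r <-] := F_full _ _ r0 => rs.
by exists r; apply: F_faithful; rewrite fmap_comp fmap_id.
Qed.

(** * Fully faithful left exact functors and the CS-Rickart property *)

Section LeftExact.
Context {A B : abelian_category} {F : functor A B}.
Hypothesis F_left_exact : left_exact F.

(** Additivity of [F] is not assumed. The morphism [0 : Z -> Y] from a zero object is a kernel of
    [1_Y], so its image is killed by [F 1_Y = 1]; every zero morphism into [Y] factors through
    it. *)
Lemma left_exact_fmap0 (X Y : A) : fmap F (0 : hom X Y) = 0.
Proof.
have [Z Z0] := has_zero_object A.
have [] := F_left_exact (@id_kernel _ Y Z 0 Z0).
rewrite fmap_id comp_idl => FZY0 _.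
by rewrite -(comp0l Y (0 : hom X Z)) fmap_comp FZY0 comp0l.
Qed.

Lemma left_exact_mono (X Y : A) (f : hom X Y) : mono f -> mono (fmap F f).
Proof. by move=> /mono_normal[Z [g fP]]; apply: kernel_mono (F_left_exact fP). Qed.

Hypothesis F_fully_faithful : fully_faithful F.

Lemma essential_mono_closed_kernels (K L : A) (e : hom K L) :
  closed_under_kernels (essential_image F) ->
  essential_mono e -> essential_mono (fmap F e).
Proof.
have [F_full F_faithful] := F_fully_faithful.
move=> closed [e_mono e_ess]; split=> [|P h hFe_mono]; first exact: left_exact_mono.
have [K' [k kP]] := has_kernels h.
have [|X [i [j [ji ij]]]] := closed _ _ _ _ _ kP.
  by exists L, (idm _), (idm _); rewrite comp_idl.
have [x Fx] := F_full _ _ (k \oc j).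
have x_mono : mono x.
  apply: (faithful_mono_reflect F_faithful); rewrite Fx.
  by apply: mono_comp (kernel_mono kP) _; apply: section_mono; exists i.
have [Q [c cP]] := has_cokernels x.
have c_mono : mono c.
  (* If [c e u = 0], then [e u = x v] for some [v], because [x] is a kernel of [c]. Then
     [h (F e) (F u) = h k j (F v) = 0], which forces [F u = 0] and [u = 0]. *)
  apply: e_ess; apply: monoP => W u; rewrite -compA => ceu0.
  have [v xv] := kernel_lift (mono_kernel_cokernel x_mono cP) ceu0.
  apply: F_faithful; rewrite left_exact_fmap0; apply: (mono_eq0 hFe_mono).
  by rewrite -compA -fmap_comp -xv fmap_comp Fx !compA kP.1 !comp0l.
have x0 : x = 0 by apply: mono_eq0 c_mono cP.1.
apply: (kernel_eq0_mono kP).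
by rewrite -[k]comp_idr -ji compA -Fx x0 left_exact_fmap0 comp0l.
Qed.

Lemma essential_mono_closed_cokernels (K L : A) (e : hom K L) :
  closed_under_cokernels (essential_image F) ->
  essential_mono e -> essential_mono (fmap F e).
Proof.
have [F_full F_faithful] := F_fully_faithful.
move=> closed [e_mono e_ess]; split=> [|P h hFe_mono]; first exact: left_exact_mono.
have [K' [k kP]] := has_kernels h; have [Q [p pP]] := has_cokernels k.
(* [h = m p] is the factorization of [h] through its coimage [Q], which is a quotient of [F L]. *)
have [m [mp _]] := pP.2 _ _ kP.1.
have [|Y [i [j [ji ij]]]] := closed _ _ _ _ _ pP.
  by exists L, (idm _), (idm _); rewrite comp_idl.
have [y Fy] := F_full _ _ (i \oc p).
have y_mono : mono y.
  apply: e_ess; apply: (faithful_mono_reflect F_faithful).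
  (* [(m j) F (y e) = m j i p (F e) = h (F e)], a monomorphism by hypothesis. *)
  apply: (@mono_compK _ _ _ _ (m \oc j)).
  by rewrite fmap_comp Fy !compA -[_ \oc j \oc i]compA ji comp_idr mp.
(* [(F y) k = i p k = 0] with [F y] a monomorphism, so the kernel [k] of [h] vanishes. *)
apply: (kernel_eq0_mono kP); apply: (mono_eq0 (left_exact_mono y_mono)).
by rewrite Fy -compA pP.1 comp0r.
Qed.

Lemma CS_Rickart_fmap (M N : A) :
  closed_under_kernels (essential_image F) \/
    closed_under_cokernels (essential_image F) ->
  CS_Rickart M N -> CS_Rickart (F M) (F N).
Proof.
move=> closed MN g K' k' k'P.
have [f Ff] := F_fully_faithful.1 _ _ g; rewrite -{}Ff in k'P.
have [K [k kP]] := has_kernels f.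
have [L [e [s [e_ess [r rs] kse]]]] := MN _ _ _ kP.
(* The given kernel [k'] need not be [F k]; the comparison isomorphism [u] is absorbed into the
   essential part. *)
have [u [v [vu uv k'E]]] := kernel_unique (F_left_exact kP) k'P.
exists (F L), (fmap F e \oc u), (fmap F s); split.
- apply: essential_mono_isor vu uv _; case: closed => closed.
    exact: essential_mono_closed_kernels.
  exact: essential_mono_closed_cokernels.
- by exists (fmap F r); rewrite -fmap_comp rs fmap_id.
- by rewrite k'E kse fmap_comp compA.
Qed.

Lemma CS_Rickart_reflect (M N : A) :
  closed_under_direct_summands (essential_image F) ->
  CS_Rickart (F M) (F N) -> CS_Rickart M N.
Proof.
have [F_full F_faithful] := F_fully_faithful.
move=> closed MN f K k kP.
have [L0 [e0 [s0 [e0_ess s0_sec kse]]]] := MN _ _ _ (F_left_exact kP).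
have [|L [i [j [ji ij]]]] := closed _ _ (section_direct_summand s0_sec).
  by exists M, (idm _), (idm _); rewrite comp_idl.
(* The factorization of [F k] is moved along the isomorphism between [L0] and [F L], where fullness
   lifts both factors to [A]. *)
have [e Fe] := F_full _ _ (i \oc e0); have [s Fs] := F_full _ _ (s0 \oc j).
have [Fe_mono Fe_ess] : essential_mono (fmap F e).
  by rewrite Fe; apply: essential_mono_isol ji ij e0_ess.
exists L, e, s; split.
- split=> [|P h he_mono]; apply: (faithful_mono_reflect F_faithful) => //.
  by apply: Fe_ess; rewrite -fmap_comp; apply: left_exact_mono.
- apply: (fully_faithful_section F_fully_faithful).
  have [r rs] := s0_sec; exists (i \oc r).
  by rewrite Fs compA -[_ \oc r \oc s0]compA rs comp_idr.
- apply: F_faithful; rewrite fmap_comp Fs Fe kse compA -[_ \oc j \oc i]compA.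
  by rewrite ji comp_idr.
Qed.

End LeftExact.

(** * Opposite categories and duality *)

Definition op_preadditive (C : preadditive_category) : preadditive_category :=
  @PreadditiveCategory C (fun X Y => hom Y X) (@idm C)
    (fun X Y Z g f => f \oc g)
    (fun X Y f => comp_idr f)
    (fun X Y f => comp_idl f)
    (fun W X Y Z h g f => esym (compA f g h))
    (fun X Y Z g g' f => compDr f g g')
    (fun X Y Z g f f' => compDl f f' g).

Lemma op_biproduct (C : preadditive_category) (X Y S : C)
    (i : hom X S) (j : hom Y S) (p : hom S X) (q : hom S Y) :
  is_biproduct i j p q -> @is_biproduct (op_preadditive C) X Y S p q i j.
Proof. by case. Qed.

Lemma op_direct_summand (C : preadditive_category) (X S : C) :
  @is_direct_summand (op_preadditive C) X S -> is_direct_summand X S.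
Proof. by case=> Y [i [j [p [q []]]]]; exists Y, p, q, i, j. Qed.

Lemma op_has_biproducts (C : abelian_category) (X Y : op_preadditive C) :
  exists (S : op_preadditive C)
    (i : hom X S) (j : hom Y S) (p : hom S X) (q : hom S Y), is_biproduct i j p q.
Proof.
have [S [i [j [p [q /op_biproduct XY]]]]] := has_biproducts (X : C) (Y : C).
by exists S, p, q, i, j.
Qed.

Lemma op_has_zero_object (C : abelian_category) :
  exists Z : op_preadditive C, is_zero_object Z.
Proof.
have [Z Z0] := has_zero_object C.
by exists Z => X; split; [exact: (Z0 X).2 | exact: (Z0 X).1].
Qed.

(** Kernels and monomorphisms of the opposite category are, by conversion, cokernels and
    epimorphisms of [C]. Only zero objects and biproducts need their data rearranged. *)
Definition op_abelian (C : abelian_category) : abelian_category :=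
  @AbelianCategory (op_preadditive C) (op_has_zero_object C) (@op_has_biproducts C)
    (fun X Y f => has_cokernels f)
    (fun X Y f => has_kernels f)
    (fun X Y f => @epi_conormal C Y X f)
    (fun X Y f => @mono_normal C Y X f).

Definition op_functor (A B : preadditive_category) (F : functor A B) :
    functor (op_preadditive A) (op_preadditive B) :=
  @Functor (op_preadditive A) (op_preadditive B) F (fun X Y f => fmap F f)
    (fmap_id F) (fun X Y Z g f => fmap_comp F f g).

Lemma op_fully_faithful (A B : preadditive_category) (F : functor A B) :
  fully_faithful F -> fully_faithful (op_functor F).
Proof.
by case=> F_full F_faithful; split=> X Y; [exact: F_full | exact: F_faithful].
Qed.

Lemma op_left_exact (A B : preadditive_category) (F : functor A B) :
  right_exact F -> left_exact (op_functor F).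
Proof. by move=> F_right_exact X Y K f k; exact: F_right_exact. Qed.

Lemma op_essential_image (A B : preadditive_category) (F : functor A B) (Y : B) :
  essential_image (op_functor F) Y <-> essential_image F Y.
Proof. by split=> -[X [f [g [gf fg]]]]; exists X, g, f. Qed.

Lemma op_CS_Rickart (C : preadditive_category) (M N : C) :
  @CS_Rickart (op_preadditive C) N M <-> dual_CS_Rickart M N.
Proof.
split=> MN f Q c cP.
  by have [P [t [r [t_sup r_ret cE]]]] := MN f Q c cP; exists P, r, t.
by have [P [r [t [r_ret t_sup cE]]]] := MN f Q c cP; exists P, t, r.
Qed.

Lemma op_closed_kernels (A B : preadditive_category) (F : functor A B) :
  closed_under_cokernels (essential_image F) ->
  closed_under_kernels (essential_image (op_functor F)).
Proof.
move=> closed X Y K f k kP /op_essential_image FX.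
exact/op_essential_image/(closed Y X K f k kP FX).
Qed.

Lemma op_closed_cokernels (A B : preadditive_category) (F : functor A B) :
  closed_under_kernels (essential_image F) ->
  closed_under_cokernels (essential_image (op_functor F)).
Proof.
move=> closed X Y Q f c cP /op_essential_image FY.
exact/op_essential_image/(closed Y X Q f c cP FY).
Qed.

Lemma op_closed_direct_summands (A B : preadditive_category) (F : functor A B) :
  closed_under_direct_summands (essential_image F) ->
  closed_under_direct_summands (essential_image (op_functor F)).
Proof.
move=> closed X Y /op_direct_summand XY /op_essential_image FY.
exact/op_essential_image/(closed X Y XY FY).
Qed.

Theorem theorem2p6 (A B : abelian_category) (F : functor A B) (M N : A)
    (F_fully_faithful : fully_faithful F) :
  (closed_under_kernels (essential_image F) \/
   closed_under_cokernels (essential_image F) ->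
     (left_exact F -> CS_Rickart M N -> CS_Rickart (F M) (F N)) /\
     (right_exact F -> dual_CS_Rickart M N -> dual_CS_Rickart (F M) (F N))) /\
  (closed_under_direct_summands (essential_image F) ->
     (left_exact F -> CS_Rickart (F M) (F N) -> CS_Rickart M N) /\
     (right_exact F -> dual_CS_Rickart (F M) (F N) -> dual_CS_Rickart M N)).
Proof.
have Fop_ff := op_fully_faithful F_fully_faithful.
split=> closed; split.
- by move=> F_left_exact; apply: CS_Rickart_fmap.
- move=> /op_left_exact Fop_left_exact /op_CS_Rickart MN; apply/op_CS_Rickart.
  apply: (@CS_Rickart_fmap (op_abelian A) (op_abelian B) (op_functor F)) MN => //.
  (* Duality exchanges the two closure alternatives, so their disjunction is self-dual. *)
  by case: closed => [/op_closed_cokernels | /op_closed_kernels]; [right | left].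
- by move=> F_left_exact; apply: CS_Rickart_reflect.
- move=> /op_left_exact Fop_left_exact /op_CS_Rickart MN; apply/op_CS_Rickart.
  apply: (@CS_Rickart_reflect (op_abelian A) (op_abelian B) (op_functor F)) MN => //.
  exact: op_closed_direct_summands.
Qed.
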